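(* Let $R$ be an integral domain. The following conditions are equivalent: (i) $R$ is $w$-stable; (ii) each $w$-ideal $I$ of $R$ is a divisorial ideal of the domain $E(I)$, i.e. $(E(I):(E(I):I))=I$; (iii) $R$ has $t$-finite character and $R_M$ is a stable domain for each $t$-maximal ideal $M$ of $R$.
   Context: $R$ is an integral domain with quotient field $K\neq R$. For nonzero $R$-submodules $A,B$ of $K$, $(A:B)=\{x\in K: xB\subseteq A\}$; for a nonzero ideal $I$, $E(I)=(I:I)$. For a nonzero fractional ideal $I$, $I_v=(R:(R:I))$, $I_t=\bigcup\{J_v: J\subseteq I\text{ nonzero finitely generated}\}$; $t\text{-Max}(R)$ is the set of ideals maximal among proper $t$-ideals (ideals with $I=I_t$). For a nonzero $R$-submodule $E$ of $K$, $E_w=\bigcap_{M\in t\text{-Max}(R)}ER_M$; $I$ is a $w$-ideal if $I=I_w$. A $w$-ideal $I$ is $w$-stable if $(I(E(I):I))_w=E(I)$, and $R$ is $w$-stable if every $w$-ideal is $w$-stable. $R$ has $t$-finite character if each nonzero element lies in only finitely many $t$-maximal ideals. A domain $D$ is stable if every nonzero ideal $I$ of $D$ is invertible in the overring $(I:I)$, i.e. $I((I:I):I)=(I:I)$. *)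

(* Defs.v *)
From HB Require Import structures.
From mathcomp Require Import all_boot all_order all_algebra.
Set Implicit Arguments. Unset Strict Implicit. Unset Printing Implicit Defensive.
Import GRing.Theory.
Local Open Scope ring_scope.

Section Defs.
Variable K : fieldType.

Definition incl (A B : K -> Prop) := forall x, A x -> B x.
Definition seteq (A B : K -> Prop) := forall x, A x <-> B x.
Definition nonzero (A : K -> Prop) := exists x, A x /\ x != 0.

Definition subring (R : K -> Prop) :=
  [/\ R 0, R 1, (forall x y, R x -> R y -> R (x - y)) &
      (forall x y, R x -> R y -> R (x * y))].
Definition quotient_field (R : K -> Prop) :=
  forall x, exists a b, [/\ R a, R b, b != 0 & x = a / b].

Definition submod (D A : K -> Prop) :=
  [/\ A 0, (forall x y, A x -> A y -> A (x + y)) &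
      (forall r x, D r -> A x -> A (r * x))].
Definition ideal (D I : K -> Prop) := submod D I /\ incl I D.

Definition colon (A B : K -> Prop) : K -> Prop := fun x => forall b, B b -> A (x * b).
Definition Eend (I : K -> Prop) := colon I I.
Definition mulm (A B : K -> Prop) : K -> Prop := fun x =>
  exists s : seq (K * K), (forall p, p \in s -> A p.1 /\ B p.2) /\
                          x = \sum_(p <- s) p.1 * p.2.

Definition vcl (R I : K -> Prop) := colon R (colon R I).
Definition span (R : K -> Prop) (s : seq K) : K -> Prop := fun x =>
  exists r : nat -> K, (forall i, R (r i)) /\ x = \sum_(i < size s) r i * s`_i.
Definition tcl (R I : K -> Prop) : K -> Prop := fun x =>
  exists s : seq K, [/\ nonzero (span R s), incl (span R s) I & vcl R (span R s) x].

Definition t_ideal (R I : K -> Prop) := [/\ ideal R I, nonzero I & seteq I (tcl R I)].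
Definition proper (R I : K -> Prop) := exists x, R x /\ ~ I x.
Definition t_max (R M : K -> Prop) :=
  [/\ t_ideal R M, proper R M &
      forall N, t_ideal R N -> proper R N -> incl M N -> seteq N M].

Definition loc (R M : K -> Prop) : K -> Prop := fun x =>
  exists a s, [/\ R a, R s, ~ M s & x = a / s].

Definition wcl (R A : K -> Prop) : K -> Prop := fun x =>
  forall M, t_max R M -> mulm A (loc R M) x.
Definition w_ideal (R I : K -> Prop) := [/\ ideal R I, nonzero I & seteq I (wcl R I)].
Definition w_stable_ideal (R I : K -> Prop) :=
  seteq (wcl R (mulm I (colon (Eend I) I))) (Eend I).
Definition w_stable (R : K -> Prop) := forall I, w_ideal R I -> w_stable_ideal R I.

Definition t_finite_character (R : K -> Prop) :=
  forall x, R x -> x != 0 ->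
  exists (n : nat) (f : nat -> K -> Prop),
    forall M, t_max R M -> M x -> exists i, (i < n)%N /\ seteq M (f i).

Definition stable_domain (D : K -> Prop) :=
  forall I, ideal D I -> nonzero I -> seteq (mulm I (colon (Eend I) I)) (Eend I).

End Defs.

(* Main.v *)
(* The working form of everything is local: [x] lies in [A_w] iff every [t]-maximal
   [M] has some [s] outside it with [s x] in [A], and [(E(I):I)] is the set of [y]
   with [y I I <= I], so [I] is [w]-stable iff no [t]-maximal ideal contains all
   of [R] cap [I (E(I):I)].

   (i) <=> (ii): if [I] and [J = (I(E(I):I))_w] are both divisorial in their
   endomorphism rings, then [E(J) = (E(I):J) = E(I)], so [J = E(I)].

   (iii) => (i): write [1] as a finite sum in [I R_M (E(I R_M):I R_M)]; each second
   factor becomes an element of [(E(I):I)] after multiplication by one denominator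
   for each of the finitely many relevant [t]-maximal ideals [N], as [I R_N] is
   finitely generated over its endomorphism ring.

   (i) => (iii): ideals of [R_M] are localizations of their traces on [R], which
   are [w]-ideals.  For the finite character, an infinite family of finitely
   generated ideals [J_k] containing [x], no two in a common [t]-maximal ideal,
   yields the [w]-ideal generated by all [x^2 (R : J_k^2)].  As it is stable,
   finitely many [k] generate it up to its endomorphism ring, so that
   [(R_M : J_k^2)] is a ring for another [k] and some [M] containing [J_k], which
   is impossible when [R_M] is stable.  If [x] were in infinitely many
   [t]-maximal ideals, such a family would exist. *)
Require Import Defs.
From mathcomp Require Import all_boot all_order all_algebra.
From mathcomp Require Import boolp classical_sets ring.
Import Defs.
Set Implicit Arguments. Unset Strict Implicit. Unset Printing Implicit Defensive.
Import GRing.Theory.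
Local Open Scope ring_scope.

(** * Products and colons of submodules of [K] *)

Section Submodules.
Variable K : fieldType.
Implicit Types (A B D R : K -> Prop).

Lemma mulm_mem A B a b : A a -> B b -> mulm A B (a * b).
Proof.
move=> Aa Bb; exists [:: (a, b)]; rewrite big_seq1; split=> // p.
by rewrite inE => /eqP ->.
Qed.

Lemma mulm0 A B : mulm A B 0.
Proof. by exists [::]; rewrite big_nil; split. Qed.

Lemma mulmD A B x y : mulm A B x -> mulm A B y -> mulm A B (x + y).
Proof.
move=> [s [sP ->]] [t [tP ->]]; exists (s ++ t); rewrite big_cat; split=> // p.
by rewrite mem_cat => /orP[/sP|/tP].
Qed.

Lemma mulm_min A B (C : K -> Prop) :
    C 0 -> (forall x y, C x -> C y -> C (x + y)) ->
    (forall a b, A a -> B b -> C (a * b)) -> forall x, mulm A B x -> C x.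
Proof.
move=> C0 CD CM x [s [sP ->]]; elim: s sP => [|p s IH] sP.
  by rewrite big_nil.
rewrite big_cons; apply: CD.
  by have [pA pB] := sP p (mem_head _ _); apply: CM.
by apply: IH => q qs; apply: sP; rewrite inE qs orbT.
Qed.

Lemma submod_mulm D A B : submod D A -> submod D (mulm A B).
Proof.
move=> [A0 AD AZ]; split=> [||r x Dr]; [exact: mulm0|exact: mulmD|].
move: x; apply: mulm_min => [|x y|a b Aa Bb].
- by rewrite mulr0; apply: mulm0.
- by rewrite mulrDr; apply: mulmD.
- by rewrite mulrA; apply: mulm_mem => //; apply: AZ.
Qed.

Lemma submod_colon D A B : submod D A -> submod D (colon A B).
Proof.
move=> [A0 AD AZ]; split=> [b _|x y Ax Ay b Bb|r x Dr Ax b Bb].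
- by rewrite mul0r.
- by rewrite mulrDl; apply: AD; [apply: Ax|apply: Ay].
- by rewrite -mulrA; apply: AZ => //; apply: Ax.
Qed.

Lemma submod_scale D A c : submod D A -> submod D (fun x => A (c * x)).
Proof.
move=> [A0 AD AZ]; split=> [|x y|r x]; rewrite ?mulr0 ?mulrDr //; first exact: AD.
by rewrite mulrCA; apply: AZ.
Qed.

Lemma mulmS A A' B B' :
  incl A A' -> incl B B' -> incl (mulm A B) (mulm A' B').
Proof.
move=> AA BB x [s [sP ->]]; exists s; split=> // p /sP[/AA pA /BB pB].
by split.
Qed.

Lemma colon_Eend_mulm_sub D I : submod D I ->
  incl (mulm I (colon (Eend I) I)) (Eend I).
Proof.
move=> [I0 ID IZ]; apply: mulm_min => [b _|x y Ex Ey b Ib|a b Ia Xb c Ic].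
- by rewrite mul0r.
- by rewrite mulrDl; apply: ID; [apply: Ex|apply: Ey].
- by rewrite [a * b]mulrC; apply: Xb.
Qed.

Lemma Eend_mulm I B x y : Eend I x -> mulm I B y -> mulm I B (x * y).
Proof.
move=> Ex; move: y; apply: mulm_min => [|y z|a b Ia Bb].
- by rewrite mulr0; apply: mulm0.
- by rewrite mulrDr; apply: mulmD.
- by rewrite mulrA; apply: mulm_mem => //; apply: Ex.
Qed.

(** The product lies in [E(I)] and absorbs multiplication by [E(I)], so only [1] has to be
    tested. *)
Lemma stableP D I : submod D I ->
  seteq (mulm I (colon (Eend I) I)) (Eend I) <-> mulm I (colon (Eend I) I) 1.
Proof.
move=> smI; split=> [H|H x]; first by apply/H => b; rewrite mul1r.
split=> [|Ex]; first exact: colon_Eend_mulm_sub smI x.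
by rewrite -[x]mulr1; apply: Eend_mulm.
Qed.

End Submodules.

(** * The [v]-closure of finite sets and the [t]-maximal ideals *)

Section Domain.
Variables (K : fieldType) (R : K -> Prop).
Hypotheses (R_subring : subring R) (R_frac : quotient_field R).
Hypothesis R_proper : exists x : K, ~ R x.

Let R0 : R 0. Proof. by case: R_subring. Qed.
Let R1 : R 1. Proof. by case: R_subring. Qed.
Let RM x y : R x -> R y -> R (x * y). Proof. by case: R_subring => _ _ _ h; apply: h. Qed.
Let RB x y : R x -> R y -> R (x - y). Proof. by case: R_subring => _ _ h _; apply: h. Qed.
Let RN x : R x -> R (- x). Proof. by move=> Rx; rewrite -sub0r; apply: RB. Qed.
Let RD x y : R x -> R y -> R (x + y).
Proof. by move=> Rx Ry; rewrite -[y]opprK; apply: RB => //; apply: RN. Qed.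

Lemma submodR : submod R R. Proof. by []. Qed.

Lemma submod_sum A s (r : nat -> K) : submod R A -> (forall i, R (r i)) ->
  (forall b, b \in s -> A b) -> A (\sum_(i < size s) r i * s`_i).
Proof.
move=> [A0 AD AZ] Rr sA; apply: big_ind => // i _.
by apply: AZ => //; apply: sA; apply: mem_nth.
Qed.

Lemma mem_span s b : b \in s -> span R s b.
Proof.
move=> bs; exists (fun i => (i == index b s)%:R); split=> [i|]; first by case: eqP.
have lt : (index b s < size s)%N by rewrite index_mem.
rewrite (bigD1 (Ordinal lt)) //= eqxx mul1r nth_index // big1 ?addr0 // => i.
by rewrite -val_eqE /= => /negPf ->; rewrite mul0r.
Qed.

Lemma span_sub A s : submod R A ->
  incl (span R s) A <-> (forall b, b \in s -> A b).
Proof.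
move=> smA; split=> [sA b /mem_span/sA //|sA x [r [Rr ->]]].
exact: (submod_sum smA Rr sA).
Qed.

(* The divisorial closure of a submodule depends only on a set of generators. *)
Definition vseq (s : seq K) : K -> Prop := vcl R (fun b => b \in s).

Lemma vcl_span s x : vcl R (span R s) x <-> vseq s x.
Proof.
have E y : colon R (span R s) y <-> colon R (fun b => b \in s) y.
  split=> [sy b /mem_span|ys b sb]; first exact: sy.
  by apply: (span_sub s (submod_scale y submodR)).2 b sb.
by split=> sx y /E; apply: sx.
Qed.

Lemma vseq_mem s b : b \in s -> vseq s b.
Proof. by move=> bs y; rewrite mulrC; apply. Qed.

Lemma vseq_sub s t : (forall b, b \in s -> vseq t b) -> incl (vseq s) (vseq t).
Proof. by move=> st x sx y ty; apply: sx => b /st; rewrite mulrC; apply. Qed.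

Lemma vseqS s t : {subset s <= t} -> incl (vseq s) (vseq t).
Proof. by move=> st; apply: vseq_sub => b /st/vseq_mem. Qed.

Lemma vseq_submod s : submod R (vseq s). Proof. exact: submod_colon. Qed.

Lemma vseqR s : (forall b, b \in s -> R b) -> incl (vseq s) R.
Proof. by move=> sR x sx; rewrite -[x]mulr1; apply: sx => b /sR; rewrite mul1r. Qed.

(** All of [K] carries zeros into [R], while only [0] carries [K] into [R], since [R] is not [K]. *)
Lemma vseq_eq0 s x : (forall b, b \in s -> b = 0) -> vseq s x -> x = 0.
Proof.
move=> s0 sx; have [z nRz] := R_proper.
apply: contra_notP nRz => /eqP x0; rewrite -(divfK x0 z) mulrC.
by apply: sx => b /s0 ->; rewrite mulr0.
Qed.

Lemma t_ideal_vseq I s : t_ideal R I -> (forall b, b \in s -> I b) -> incl (vseq s) I.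
Proof.
move=> [[smI _] _ It] sI x sx.
have [[b bs b0]|/forall2NP s0] := pselect (exists2 b, b \in s & b != 0).
  apply/It; exists s; split; first by exists b; split=> //; apply: mem_span.
    exact/span_sub.
  exact/vcl_span.
(* [tcl] admits only nonzero submodules, so a list of zeros is handled apart. *)
rewrite (vseq_eq0 _ sx); first by case: smI.
by move=> b bs; have [|/negP/negPn/eqP] := s0 b.
Qed.

Lemma ideal_top I : submod R I -> I 1 -> incl R I.
Proof. by move=> [_ _ IZ] I1 x Rx; rewrite -[x]mulr1; apply: IZ. Qed.

Lemma t_max_not1 M : t_max R M -> ~ M 1.
Proof. by move=> [[[smM _] _ _] [x [Rx nMx]] _] /(ideal_top smM)/(_ _ Rx). Qed.

Lemma vseq_collect (N : K -> Prop) (s : seq K) :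
    (forall u, u \in s -> exists2 t : seq K, forall b, b \in t -> N b & vseq t u) ->
  exists2 t : seq K, forall b, b \in t -> N b & forall u, u \in s -> vseq t u.
Proof.
elim: s => [|a s IH] sN; first by exists [::].
have [t tN st] := IH (fun u us => sN u (@mem_behead _ (a :: s) u us)).
have [t' tN' at'] := sN a (mem_head _ _).
exists (t' ++ t) => [b|u].
  by rewrite mem_cat => /orP[/tN'|/tN].
rewrite inE => /orP[/eqP ->|/st].
  by apply: vseqS at' => b; rewrite mem_cat => ->.
by apply: vseqS => b; rewrite mem_cat orbC => ->.
Qed.

(* Zorn on the sets all of whose finite subsets [s] have [1] outside [s_v]. *)
Lemma t_max_exists_nonzero A : incl A R -> nonzero A ->
  (forall s : seq K, (forall b, b \in s -> A b) -> ~ vseq s 1) ->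
  exists M, t_max R M /\ incl A M.
Proof.
move=> AR [a [Aa a0]] As.
(* [A] stands beside [N] instead of being required inside it, so that the empty union of the empty
   chain satisfies [P]. *)
pose P (N : set K) := incl N R /\
  forall s : seq K, (forall b, b \in s -> A b \/ N b) -> ~ vseq s 1.
have [F FP Ftot|N [[NR Ns] Nmax]] := @Zorn_bigcup K P.
  split=> [x [X /FP[+ _]]|s sF]; first by apply.
  have [|[X FX sX]] : (forall b, b \in s -> A b) \/
      (exists2 X, F X & forall b, b \in s -> A b \/ X b).
  - elim: s sF => [|b s IH] sF; first by left.
    have {IH} := IH (fun c cs => sF c (@mem_behead _ (b :: s) c cs)).
    have [Ab|[Y FY Yb]] := sF b (mem_head _ _); case=> [sA|[X FX sX]].
    + by left=> c; rewrite inE => /orP[/eqP ->|/sA].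
    + by right; exists X => // c; rewrite inE => /orP[/eqP ->|/sX]; [left|].
    + right; exists Y => // c; rewrite inE => /orP[/eqP ->|/sA]; first by right.
      by left.
    + have [XY|YX] := Ftot _ _ FX FY; right; [exists Y|exists X] => // c;
        rewrite inE => /orP[/eqP ->|/sX[]]; auto.
  - exact: As.
  - by have [_] := FP _ FX; apply.
have max B : P B -> incl N B -> incl B N.
  move=> PB NB; apply: contrapT => nBN; apply: (Nmax B _ PB).
  by split=> // /subsetP sub; apply: nBN => x /sub.
have AN : incl A N.
  apply: contrapT => nAN; apply: (nAN) => x Ax.
  apply: (max (fun x => A x \/ N x)); [split=> [z [/AR|/NR] //|]| |by left].
    by move=> s sAN; apply: Ns => b /sAN; tauto.
  by move=> z; right.
(* [N'] is the [t]-closure of [N]. It satisfies [P] again, so maximality puts it inside [N]; this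
   makes [N] a [t]-ideal. *)
pose N' x := exists2 s : seq K, forall b, b \in s -> N b & vseq s x.
have N'N : incl N' N.
  apply: max => [|x Nx]; last first.
    by exists [:: x]; [move=> b /[!inE]/eqP ->|apply: vseq_mem; rewrite inE].
  split=> [x [s sN]|s sN' s1]; first by apply: vseqR => b /sN/NR.
  have [|t tN st] := @vseq_collect N s.
    move=> u /sN'[/AN Nu|//]; exists [:: u]; last by apply: vseq_mem; rewrite inE.
    by move=> b; rewrite inE => /eqP ->.
  by apply: (Ns t) => [b /tN|]; [right|apply: vseq_sub s1].
have N1 : ~ N 1.
  move=> N1; apply: (Ns [:: 1]); last by apply: vseq_mem; rewrite inE.
  by move=> b; rewrite inE => /eqP ->; right.
have tN : t_ideal R N.
  have smN : submod R N.
    split=> [|x y Nx Ny|r x Rr Nx]; apply: N'N.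
    - by exists [::] => // b _; rewrite mul0r.
    - exists [:: x; y]; first by move=> b; rewrite !inE => /orP[]/eqP ->.
      by have [_ + _] := vseq_submod [:: x; y]; apply; apply: vseq_mem;
        rewrite !inE eqxx ?orbT.
    - exists [:: x]; first by move=> b; rewrite !inE => /eqP ->.
      by have [_ _] := vseq_submod [:: x]; apply=> //; apply: vseq_mem; rewrite inE.
  split=> [||x]; [by []|by exists a; split; [apply: AN|]|split=> [Nx|]].
    (* The nonzero [a] is listed in case [x] is zero. *)
    exists [:: a; x]; split.
    + by exists a; split=> //; apply: mem_span; rewrite mem_head.
    + by apply/(span_sub _ smN) => b; rewrite !inE => /orP[]/eqP -> //; apply: AN.
    + by apply/vcl_span/vseq_mem; rewrite !inE eqxx orbT.
  move=> [s [_ /(span_sub _ smN) sN /vcl_span sx]]; apply: N'N.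
  by exists s.
exists N; split=> //; split=> [//||B tB [x [Rx nBx]] NB]; first by exists 1.
move=> z; split; last exact: NB.
have [[smB BR] _ _] := tB.
apply: (max B) => //; split=> // s sB s1; apply: nBx.
apply: (ideal_top smB) => //; apply: (t_ideal_vseq tB) s1 => b /sB [/AN/NB|] //.
Qed.

Lemma nonunit_exists : exists b, [/\ R b, b != 0 & ~ R b^-1].
Proof.
have [z nRz] := R_proper; have [a [b [Ra Rb b0 zE]]] := R_frac z.
by exists b; split=> // Rb'; apply: nRz; rewrite zE; apply: RM.
Qed.

Lemma t_max_exists A : incl A R ->
  (forall s : seq K, (forall b, b \in s -> A b) -> ~ vseq s 1) ->
  exists M, t_max R M /\ incl A M.
Proof.
move=> AR As; have [nzA|zA] := pselect (nonzero A).
  exact: t_max_exists_nonzero.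
(* Here [A] has no element but [0], so any [t]-maximal ideal will do; a nonzero nonunit supplies
   one. *)
have [b [Rb b0 nRb']] := nonunit_exists.
have [||s sb s1|M [tM bM]] := @t_max_exists_nonzero (fun x => x = b).
- by move=> x ->.
- by exists b.
- by apply: nRb'; rewrite -[b^-1]mul1r; apply: s1 => c /sb ->; rewrite mulVf.
exists M; split=> // x Ax; have -> : x = 0.
  by apply: contra_notP zA => /eqP x0; exists x.
by case: tM => [[[[]]]].
Qed.

(** The contrapositive of [t_max_exists], a compactness principle: a condition at every [t]-maximal
    ideal is reduced to finitely many elements. *)
Lemma t_max_compact A : incl A R ->
  (forall M, t_max R M -> exists2 a, A a & ~ M a) ->
  exists2 s : seq K, forall b, b \in s -> A b & vseq s 1.
Proof.
move=> AR AM; apply: contrapT => nA.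
have [s sA s1|M [tM AM']] := @t_max_exists A AR; first by apply: nA; exists s.
by have [a /AM'] := AM M tM.
Qed.

Lemma vseq1_notin s M : vseq s 1 -> t_max R M -> exists2 b, b \in s & ~ M b.
Proof.
move=> s1 tM; apply: contrapT => nM; apply: (t_max_not1 tM).
have [tiM _ _] := tM; apply: (t_ideal_vseq tiM) s1 => b bs.
by apply: contrapT => nMb; apply: nM; exists b.
Qed.

Definition prime_ideal (M : K -> Prop) := [/\ ideal R M, ~ M 1 &
  forall a b, R a -> R b -> M (a * b) -> M a \/ M b].

(** If [a] and [b] are outside [M], compactness gives finite lists from [M] with [a], and from [M]
    with [b], each having [1] in its [v]-closure. The products of their entries have the same
    property, and [a * b] in [M] would put them all in [M]. *)
Lemma t_max_prime M : t_max R M -> prime_ideal M.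
Proof.
move=> tM; have [[[smM MR] _ _] _ Mmax] := tM; have [M0 MD MZ] := smM.
split=> //; first exact: t_max_not1.
suff away a : R a -> ~ M a ->
    exists2 s : seq K, forall b, b \in s -> M b \/ b = a & vseq s 1.
  move=> a b Ra Rb Mab; apply: contrapT => /not_orP[nMa nMb].
  have [s sM s1] := away a Ra nMa; have [t tM' t1] := away b Rb nMb.
  apply: (t_max_not1 tM).
  have [tiM _ _] := tM; apply: (t_ideal_vseq tiM (s := [seq u * v | u <- s, v <- t])).
    move=> _ /allpairsP[[u v] /= [us vt ->]].
    have Ru : R u by case: (sM u us) => [/MR|->].
    have Rv : R v by case: (tM' v vt) => [/MR|->].
    case: (sM u us) => [Mu|->]; first by rewrite mulrC; apply: MZ.
    by case: (tM' v vt) => [Mv|-> //]; apply: MZ.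
  move=> y yst; apply: s1 => u us; rewrite -[y * u]mul1r; apply: t1 => v vt.
  by rewrite -mulrA; apply: yst; apply/allpairsP; exists (u, v).
move=> Ra nMa; apply: t_max_compact => [b [/MR //|->//]|N tN].
have [MN|nMN] := pselect (incl M N).
  exists a; first by right.
  by have [tiN Np _] := tN; move=> /(Mmax N tiN Np MN).
by move/existsNP: nMN => [b /not_implyP[Mb nNb]]; exists b; first by left.
Qed.

(** * Localization at a prime ideal, with a single denominator in place of finite sums *)

Definition locm (M A : K -> Prop) : K -> Prop :=
  fun x => exists s, [/\ R s, ~ M s & A (s * x)].

Section Prime.
Variable M : K -> Prop.
Hypothesis M_prime : prime_ideal M.

Lemma prime_notinM s t : R s -> ~ M s -> R t -> ~ M t -> ~ M (s * t).
Proof. by have [_ _ MP] := M_prime; move=> Rs Ms Rt Mt /(MP s t Rs Rt)[]. Qed.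

Lemma prime_notin_neq0 s : ~ M s -> s != 0.
Proof. by have [[[M0 _ _] _] _ _] := M_prime; apply: contra_notN => /eqP ->. Qed.

Lemma loc_locm x : loc R M x <-> locm M R x.
Proof.
split=> [[a [s [Ra Rs Ms ->]]]|[s [Rs Ms Rsx]]].
  by exists s; split=> //; rewrite mulrC divfK // prime_notin_neq0.
by exists (s * x), s; split=> //; rewrite mulrC mulKf // prime_notin_neq0.
Qed.

Lemma locm_mem A : incl A (locm M A).
Proof. by move=> x Ax; exists 1; have [_ M1 _] := M_prime; rewrite mul1r. Qed.

Lemma locmS A B : incl A B -> incl (locm M A) (locm M B).
Proof. by move=> AB x [s [Rs Ms /AB Bsx]]; exists s. Qed.

Lemma locm_locm A : incl (locm M (locm M A)) (locm M A).
Proof.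
move=> x [s [Rs Ms [t [Rt Mt Atsx]]]]; exists (t * s); rewrite -mulrA.
by split; [apply: RM|apply: prime_notinM|].
Qed.

Lemma locm_mul A B C x y : (forall u v, A u -> B v -> C (u * v)) ->
  locm M A x -> locm M B y -> locm M C (x * y).
Proof.
move=> ABC [s [Rs Ms Asx]] [t [Rt Mt Bty]]; exists (s * t); rewrite mulrACA.
by split; [apply: RM|apply: prime_notinM|apply: ABC].
Qed.

Lemma locm_submod A : submod R A -> submod (locm M R) (locm M A).
Proof.
move=> [A0 AD AZ]; split=> [|x y [s [Rs Ms Asx]] [t [Rt Mt Aty]]|r x Rr Ax].
- exact: locm_mem.
- exists (s * t); rewrite mulrDr -mulrA mulrCA -mulrA.
  by split; [apply: RM|apply: prime_notinM|apply: AD; apply: AZ].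
- exact: locm_mul Rr Ax.
Qed.

Lemma locm_submodR A : submod R A -> submod R (locm M A).
Proof.
by move=> /locm_submod[L0 LD LZ]; split=> // r x /locm_mem; apply: LZ.
Qed.

Lemma mulm_locE A x : submod R A -> mulm A (loc R M) x <-> locm M A x.
Proof.
move=> smA; have [A0 AD AZ] := smA; have [L0 LD LZ] := locm_submod smA; split.
  move: x; apply: mulm_min => // a b Aa /loc_locm Rb.
  by rewrite mulrC; apply: LZ => //; apply: locm_mem.
move=> [s [Rs Ms Asx]]; have s0 := prime_notin_neq0 Ms.
rewrite -(mulKf s0 x) mulrC; apply: mulm_mem => //.
by apply/loc_locm; exists s; rewrite divff.
Qed.

Lemma common_multiple (T : eqType) (s : seq T) (Q : T -> K -> Prop) :
    (forall u r t, R r -> Q u t -> Q u (r * t)) ->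
    (forall u, u \in s -> exists t, [/\ R t, ~ M t & Q u t]) ->
  exists t, [/\ R t, ~ M t & forall u, u \in s -> Q u t].
Proof.
move=> QZ; elim: s => [|a s IH] sQ.
  by exists 1; have [_ M1 _] := M_prime.
have [t [Rt Mt Qt]] := IH (fun u us => sQ u (@mem_behead _ (a :: s) u us)).
have [r [Rr Mr Qr]] := sQ a (mem_head _ _).
exists (r * t); split=> [||u]; [exact: RM|exact: prime_notinM|].
by rewrite inE => /orP[/eqP ->|/Qt/QZ]; [rewrite mulrC; apply: QZ|apply].
Qed.

End Prime.

(** * The [w]-closure and [w]-ideals *)

Lemma wclE A x : submod R A ->
  wcl R A x <-> forall M, t_max R M -> locm M A x.
Proof.
by move=> smA; split=> Ax M tM; apply/(mulm_locE (t_max_prime tM) _ smA)/Ax.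
Qed.

(** No [t]-maximal ideal contains all denominators of [x], so [1] is in the [v]-closure of finitely
    many of them. As [x] carries these into [R], it carries [1] into [R]. *)
Lemma t_max_cap x : (forall M, t_max R M -> locm M R x) -> R x.
Proof.
move=> Rx.
have [a []//|M tM|s sR s1] := @t_max_compact (fun a => R a /\ R (a * x)).
  by have [a [Ra Ma Rax]] := Rx M tM; exists a.
by rewrite -[x]mul1r; apply: s1 => b /sR[]; rewrite mulrC.
Qed.

Lemma wcl_mem A : submod R A -> incl A (wcl R A).
Proof. by move=> smA x Ax; apply/wclE => // M /t_max_prime pM; apply: locm_mem. Qed.

Lemma submod_wcl A : submod R A -> submod R (wcl R A).
Proof.
move=> smA; have [A0 AD AZ] := smA.
split=> [|x y /(wclE _ smA) Ax /(wclE _ smA) Ay|r x Rr /(wclE _ smA) Ax].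
- exact: wcl_mem.
- apply/wclE => // M tM; have [_ LD _] := locm_submod (t_max_prime tM) smA.
  by apply: LD; [apply: Ax|apply: Ay].
- apply/wclE => // M tM; have [_ _ LZ] := locm_submod (t_max_prime tM) smA.
  by apply: LZ; [apply: locm_mem => //; apply: t_max_prime|apply: Ax].
Qed.

Lemma wcl_subR A : submod R A -> incl A R -> incl (wcl R A) R.
Proof.
move=> smA AR x /(wclE _ smA) Ax; apply: t_max_cap => M /Ax.
exact: locmS.
Qed.

Lemma w_ideal_mem I x : w_ideal R I -> (forall M, t_max R M -> locm M I x) -> I x.
Proof. by move=> [[smI _] _ Iw] Ix; apply/Iw/wclE. Qed.

Lemma w_ideal_intro I : submod R I -> incl I R -> nonzero I ->
  (forall x, (forall M, t_max R M -> locm M I x) -> I x) -> w_ideal R I.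
Proof.
move=> smI IR I0 Iw; split=> // x; split; first exact: wcl_mem.
by move=> /(wclE _ smI)/Iw.
Qed.

Lemma wcl_locm A x : submod R A ->
  (forall M, t_max R M -> locm M (wcl R A) x) -> wcl R A x.
Proof.
move=> smA Ax; apply/wclE => // M tM; apply: (locm_locm (t_max_prime tM)).
by apply: locmS (Ax M tM) => y /(wclE _ smA); apply.
Qed.

Lemma w_ideal_wcl A : submod R A -> incl A R -> nonzero A -> w_ideal R (wcl R A).
Proof.
move=> smA AR [a [Aa a0]]; apply: w_ideal_intro.
- exact: submod_wcl.
- exact: wcl_subR.
- by exists a; split=> //; apply: wcl_mem.
- by move=> x; apply: wcl_locm.
Qed.

Lemma wcl_colon_Eend_sub I : w_ideal R I ->
  incl (wcl R (mulm I (colon (Eend I) I))) (Eend I).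
Proof.
move=> wI; have [[smI IR] I0 _] := wI => x /(wclE _ (submod_mulm _ smI)) Ex b Ib.
apply: (w_ideal_mem wI) => M tM; have pM := t_max_prime tM.
apply: (locm_mul pM _ (Ex M tM)) (locm_mem pM Ib).
by move=> u v /(colon_Eend_mulm_sub smI); apply.
Qed.

Lemma w_stable_idealP I : w_ideal R I ->
  w_stable_ideal R I <->
  forall M, t_max R M -> locm M (mulm I (colon (Eend I) I)) 1.
Proof.
move=> wI; have [[smI IR] I0 _] := wI.
have smIX := submod_mulm (colon (Eend I) I) smI.
split=> [st M|st x].
  by move: M; apply/wclE => //; apply/st => b; rewrite mul1r.
split=> [|Ex]; first exact: wcl_colon_Eend_sub.
apply/wclE => // M /st [s [Rs Ms]]; rewrite mulr1 => IXs; exists s; split=> //.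
by rewrite mulrC; apply: Eend_mulm.
Qed.

(** * Stability and divisoriality *)

Lemma w_stable_divisorial I : w_ideal R I -> w_stable_ideal R I ->
  seteq (colon (Eend I) (colon (Eend I) I)) I.
Proof.
move=> wI /(w_stable_idealP wI) st x; have [[[I0 ID _] _] _ _] := wI.
split=> [Ex|Ix y Xy]; last by rewrite mulrC; apply: Xy.
(* [s] is a sum of products [a * b] with [b] in [(E(I):I)]; each [x * b] is in [E(I)], so [s * x] is
   in [I]. *)
apply: (w_ideal_mem wI) => M /st[s [Rs Ms]]; rewrite mulr1 => IXs.
exists s; split=> //; move: s {Rs Ms} IXs; apply: mulm_min => [|y z Iy Iz|a b Ia Xb].
- by rewrite mul0r.
- by rewrite mulrDl; apply: ID.
- have -> : a * b * x = x * b * a by ring.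
  exact: Ex.
Qed.

(* With [J = (I(E:I))_w], divisoriality of [I] gives [(E:J) = E = E(J)], and
   divisoriality of [J] then forces [J = E]. *)
Lemma divisorial_w_stable :
  (forall I, w_ideal R I -> seteq (colon (Eend I) (colon (Eend I) I)) I) ->
  w_stable R.
Proof.
move=> divI I wI; apply/w_stable_idealP => //.
have [[smI IR] [c [Ic c0]] _] := wI; have [I0 ID IZ] := smI.
set X := colon (Eend I) I; have smIX : submod R (mulm I X) by apply: submod_mulm.
pose J := wcl R (mulm I X).
have JE : incl J (Eend I) by apply: wcl_colon_Eend_sub.
suff J1 : J 1 by move=> M; move: M; apply/wclE.
(* For [a] in [I], [v * a] carries [(E(I):I)] into [E(I)], so divisoriality of [I] puts it in
   [I]. *)
have EJ v : (forall j, J j -> Eend I (v * j)) -> Eend I v.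
  move=> vJ a Ia; apply/(divI I wI) => b Xb; rewrite -mulrA.
  by apply/vJ/wcl_mem => //; apply: mulm_mem.
(* The hypothesis concerns ideals of [R], so [J] is replaced by [c J], which lies in [I]. *)
pose A z := J (c^-1 * z).
have smJ : submod R J by apply: submod_wcl.
have smA : submod R A by apply: submod_scale.
have wA : w_ideal R A.
  apply: w_ideal_intro => // [z /JE/(_ c Ic)||z Az].
  - by rewrite mulrC mulVKf // => /IR.
  - exists (c * c); rewrite mulf_neq0 //; split=> //; rewrite /A mulKf //.
    apply: wcl_mem => //; rewrite -[c]mulr1; apply: mulm_mem => // u Iu v Iv.
    by rewrite mul1r; apply: IZ => //; apply: IR.
  - apply: wcl_locm => // M /Az[s [Rs Ms As]]; exists s; split=> //.
    by rewrite mulrCA.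
suff : A c by rewrite /A mulVf.
apply/(divI A wA) => y Xy.
suff Ey : Eend I (c * y).
  move=> z Az; apply/wclE => // M tM; rewrite mulrCA.
  have /(wclE _ smIX)/(_ M tM) [s [Rs Ms JA]] := Az.
  by exists s; split=> //; rewrite (mulrCA s); apply: Eend_mulm.
(* [y] sends [c J] times [c J] into [c J], so [c * y] sends [J] times [J] into [J]; each use of [EJ]
   removes one factor. *)
apply: (EJ) => j Jj; apply: EJ => j' Jj'; apply: JE.
have Ac u : J u -> A (c * u) by rewrite /A mulKf.
have := Xy _ (Ac _ Jj) _ (Ac _ Jj'); rewrite /A; congr J.
by field.
Qed.

(** * Passing between [w]-stability of [R] and stability of its localizations *)

Section PrimeLocal.
Variables (M J : K -> Prop).
Hypotheses (M_prime : prime_ideal M) (J_sub : submod (loc R M) J).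

Lemma loc_saturated x : locm M J x -> J x.
Proof.
have [J0 JD JZ] := J_sub; move=> [s [Rs Ms Jsx]].
have s0 := prime_notin_neq0 M_prime Ms; rewrite -(mulKf s0 x); apply: JZ => //.
by apply/(loc_locm M_prime); exists s; rewrite divff.
Qed.

Lemma loc_submodR : submod R J.
Proof.
have [J0 JD JZ] := J_sub; split=> // r x Rr; apply: JZ.
by apply/(loc_locm M_prime)/locm_mem.
Qed.

End PrimeLocal.

Lemma w_stable_local M : w_stable R -> t_max R M -> stable_domain (loc R M).
Proof.
move=> st tM J [smJ JR] [a [Ja a0]]; apply/(stableP smJ).
have pM := t_max_prime tM; have smJR := loc_submodR pM smJ.
have [J0 JD JZ] := smJR.
pose I x := R x /\ J x.
have JI u : J u -> locm M I u.
  move=> Ju; have /JR/(loc_locm pM)[s [Rs Ms Rsu]] := Ju.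
  by exists s; split=> //; split=> //; apply: JZ.
have wI : w_ideal R I.
  apply: w_ideal_intro.
  - split=> [|x y [Rx Jx] [Ry Jy]|r x Rr [Rx Jx]]; split; auto.
  - by move=> x [].
  - have [s [Rs Ms Is]] := JI a Ja; exists (s * a); split=> //.
    by rewrite mulf_neq0 // (prime_notin_neq0 pM).
  (* Membership in [R] takes all [t]-maximal ideals, membership in [J] only [M]. *)
  - move=> x Ix; split; first by apply: t_max_cap => N /Ix; apply: locmS => ? [].
    by apply: (loc_saturated pM smJ); apply: locmS (Ix M tM) => ? [].
have /(w_stable_idealP wI)/(_ M tM) IX := st I wI.
apply: (loc_saturated pM (submod_mulm _ smJ)).
apply: locmS IX; apply: mulmS => [x []//|y Xy u Ju v Jv].
apply: (loc_saturated pM smJ).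
have [s [Rs Ms Isu]] := JI u Ju; have [t [Rt Mt Itv]] := JI v Jv.
exists (s * t); split; [exact: RM|exact: (prime_notinM pM)|].
have -> : s * t * (y * u * v) = y * (s * u) * (t * v) by ring.
by have [] := Xy _ Isu _ Itv.
Qed.

(* [I R_N] is generated over [E(I R_N)] by finitely many elements [d b] of [I],
   and the products [y (d b) (d b')] need only one common denominator at [M]. *)
Lemma stable_colon_transfer I M N y : submod R I -> incl I R -> nonzero I ->
    prime_ideal M -> prime_ideal N -> stable_domain (loc R N) ->
    (forall u v, I u -> I v -> locm M I (y * u * v)) ->
  exists t, [/\ R t, ~ M t & forall u v, I u -> I v -> locm N I (t * y * u * v)].
Proof.
move=> smI IR [c [Ic c0]] pM pN stN yM.
have smJ := locm_submod pN smI; pose J := locm N I.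
have [J0 JD JZ] := smJ.
have locE : loc R N = locm N R by apply/predeqP => x; apply: loc_locm.
rewrite locE in stN.
have [s [sP s1]] : mulm J (colon (Eend J) J) 1.
  apply/(stableP smJ)/stN; first by split=> //; apply: locmS.
  by exists c; split=> //; apply: locm_mem.
have [d [Rd Nd sd]] : exists d, [/\ R d, ~ N d & forall p, p \in s -> I (d * p.1)].
  have [_ _ IZ] := smI; apply: common_multiple => [//|p r t Rr|p /sP[]//].
  by rewrite -mulrA; apply: IZ.
have [t [Rt Mt st]] : exists t, [/\ R t, ~ M t &
    forall pq : (K * K) * (K * K), pq \in [seq (p, q) | p <- s, q <- s] ->
      I (t * (y * (d * pq.1.1) * (d * pq.2.1)))].
  have [_ _ IZ] := smI; apply: common_multiple => [//|p r t Rr|pq].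
    by rewrite -(mulrA r); apply: IZ.
  by case/allpairsP=> -[p q] /= [ps qs ->]; apply: yM; apply: sd.
exists t; split=> // u v Iu Iv; have JI := locm_mem pN; apply: (locm_locm pN).
exists (d * d); split; [exact: RM|exact: (prime_notinM pN)|].
(* The expansion of [1] is inserted twice: [p.2] goes with [u] and [q.2] with [v], giving elements
   of [E(J)], while [p.1] and [q.1] are covered by [t]. *)
have -> : d * d * (t * y * u * v) =
    \sum_(p <- s) \sum_(q <- s) d * d * t * y * u * v * ((p.1 * p.2) * (q.1 * q.2)).
  under eq_bigr do rewrite -mulr_sumr.
  by rewrite -mulr_sumr -big_distrlr /= -s1 !mulr1 !mulrA.
rewrite big_seq; apply: big_ind => // p ps.
rewrite big_seq; apply: big_ind => // q qs.
have [_ /(_ _ (JI _ _ Iu)) Epu] := sP p ps.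
have [_ /(_ _ (JI _ _ Iv)) Eqv] := sP q qs.
have /JI/Epu/Eqv := st _ (allpairs_f (fun p q => (p, q)) ps qs); congr J => /=.
by ring.
Qed.

Lemma local_w_stable : t_finite_character R ->
  (forall M, t_max R M -> stable_domain (loc R M)) -> w_stable R.
Proof.
move=> tfc stR I wI; apply/w_stable_idealP => // M tM; have pM := t_max_prime tM.
have [[smI IR] [c [Ic c0]] _] := wI; have [I0 ID IZ] := smI.
have smJ := locm_submod pM smI; pose J := locm M I.
have JI : incl I J by apply: locm_mem.
have locE : loc R M = locm M R by apply/predeqP => x; apply: loc_locm.
have : mulm J (colon (Eend J) J) 1.
  have := stR M tM; rewrite locE => stM; apply/(stableP smJ)/stM.
    by split=> //; apply: locmS.
  by exists c; split=> //; apply: JI.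
have [L0 LD LZ] := locm_submodR pM (submod_mulm (colon (Eend I) I) smI).
apply: mulm_min => // a y Ja Xy; apply: (locm_mul pM _ Ja); first exact: mulm_mem.
have [r [e [Rr Re e0 yE]]] := R_frac y.
(* Where [c * e] lies outside [N], it is itself a denominator for [t * y * u * v]. Only the finitely
   many [N] containing it constrain [t]. *)
have [|n [f nf]] := tfc (c * e) _ (mulf_neq0 c0 e0); first by apply: RM => //; apply: IR.
have [t [Rt Mt tI]] : exists t, [/\ R t, ~ M t & forall i, i \in iota 0 n ->
   forall N, t_max R N -> seteq N (f i) ->
   forall u v, I u -> I v -> locm N I (t * y * u * v)].
  apply: common_multiple => // [i x t Rx tI N tN Nf u v Iu Iv|i _].
    have [_ _ NZ] := locm_submodR (t_max_prime tN) smI.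
    by rewrite -!(mulrA x); apply: NZ => //; apply: tI.
  have [[N0 tN0 Nf0]|nN] := pselect (exists2 N, t_max R N & seteq N (f i)).
    have [t [Rt Mt tI]] : exists t, [/\ R t, ~ M t &
        forall u v, I u -> I v -> locm N0 I (t * y * u * v)].
      apply: stable_colon_transfer => //; [by exists c|exact: t_max_prime|exact: stR|].
      by move=> u v Iu Iv; apply: Xy; apply: JI.
    exists t; split=> // N tN Nf; suff -> : N = N0 by [].
    by apply/predeqP => x; rewrite (Nf x) (Nf0 x).
  (* [f i] need not be [t]-maximal; then the condition is void. *)
  exists 1; split=> // [|N tN Nf]; first exact: t_max_not1.
  by case: nN; exists N.
exists t; split=> // u Iu v Iv; apply: (w_ideal_mem wI) => N tN.
have [Nce|nNce] := pselect (N (c * e)).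
  have [i [ltin Nf]] := nf N tN Nce; apply: (tI i) => //.
  by rewrite mem_iota.
exists (c * e); split=> //; first by apply: RM => //; apply: IR.
have -> : c * e * (t * y * u * v) = (t * r * u * v) * c by rewrite yE; field.
apply: IZ => //; apply: RM; last exact: IR.
by apply: RM; [exact: RM|exact: IR].
Qed.

(** * Finiteness of [t]-comaximal families *)

(* For the ideal [J] generated by [s], the inverse [(E(J):J)] lies in [(R_M:J^2)];
   if the latter is a ring, it contains all powers of the former. *)
Lemma stable_colon_sqr_not_ring M (s : seq K) a : prime_ideal M ->
    stable_domain (loc R M) -> a \in s -> a != 0 -> (forall u, u \in s -> M u) ->
    let T z := forall u v, u \in s -> v \in s -> locm M R (z * u * v) in
  ~ (forall z z', T z -> T z' -> T (z * z')).
Proof.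
move=> pM stM sa a0 sM T TM; have [[[M0 MD MZ] MR] nM1 _] := pM.
have smL := locm_submod pM submodR; have [L0 LD LZ] := smL.
have LI := locm_mem pM.
have locE : loc R M = locm M R by apply/predeqP => x; apply: loc_locm.
rewrite locE in stM.
pose J := mulm (locm M R) (fun u => u \in s).
have smJ : submod (locm M R) J by apply: submod_mulm.
have Js u : u \in s -> J u.
  by move=> su; rewrite -[u]mul1r; apply: mulm_mem => //; apply: LI.
have JM : incl J (locm M M).
  have [N0 ND _] := locm_submodR pM (And3 M0 MD MZ).
  apply: mulm_min => // x u Rx /sM/LI Mu; apply: (locm_mul pM _ Rx Mu).
  by move=> r z Rr; apply: MZ.
have JR : incl J (locm M R) by move=> x /JM; apply: locmS.
have TJJ z x y : T z -> J x -> J y -> locm M R (z * x * y).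
  move=> Tz Jx Jy; move: x Jx.
  apply: (mulm_min (C := fun x => locm M R (z * x * y))) => [|x x'|r u Rr su].
  - by rewrite mulr0 mul0r.
  - by rewrite mulrDr mulrDl; apply: LD.
  move: y Jy.
  apply: (mulm_min (C := fun y => locm M R (z * (r * u) * y))) => [|x x'|r' v Rr' sv].
  - by rewrite mulr0.
  - by rewrite mulrDr; apply: LD.
  have -> : z * (r * u) * (r' * v) = r * (r' * (z * u * v)) by ring.
  by apply: (LZ) => //; apply: LZ => //; apply: Tz.
pose X := colon (Eend J) J.
have J1 : mulm J X 1 by apply/(stableP smJ)/stM => //; exists a; split=> //; apply: Js.
have XT y : X y -> T y by move=> Xy u v su sv; apply/JR/Xy; apply: Js.
(* Write [y] as [y * 1 * 1] and expand each [1] in [J X]: three factors from [X] multiply inside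
   [T], and two factors from [J] bring the product into [R_M]. *)
have XR y : X y -> locm M R y.
  move=> Xy; rewrite -[y]mulr1 -[y * 1]mulr1.
  suff step p q : mulm J X p -> mulm J X q -> locm M R (y * p * q) by apply: step.
  move=> Jp Jq; move: p Jp.
  apply: (mulm_min (C := fun x => locm M R (y * x * q))) => [|x x'|b w Jb Xw].
  - by rewrite mulr0 mul0r.
  - by rewrite mulrDr mulrDl; apply: LD.
  move: q Jq.
  apply: (mulm_min (C := fun q => locm M R (y * (b * w) * q))) => [|x x'|c w' Jc Xw'].
  - by rewrite mulr0.
  - by rewrite mulrDr; apply: LD.
  have -> : y * (b * w) * (c * w') = (y * w * w') * b * c by ring.
  by apply: TJJ => //; apply: (TM); [apply: TM|]; apply: XT.
(* Since [X] lies in [R_M], [1] in [J X] is already in [J], hence in [M R_M]. *)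
have /JM[t [Rt Mt]] : J 1.
  have [J0 JD JZ] := smJ.
  by move: J1; apply: mulm_min => // b w Jb /XR Rw; rewrite mulrC; apply: JZ.
by rewrite mulr1.
Qed.

(* The [w]-ideal generated by [x^2 (R : s^2)], for [s] in [F], is finitely generated
   up to its endomorphism ring, so finitely many [s] suffice; at a [t]-maximal
   ideal over another [s], this makes [(R_M : s^2)] a ring. *)
Lemma t_comaximal_family_finite x (F : seq K -> Prop) : w_stable R ->
    R x -> x != 0 -> (forall s, F s -> x \in s) ->
    (forall s, F s -> exists M, t_max R M /\ forall u, u \in s -> M u) ->
    (forall s s' M, F s -> F s' -> t_max R M ->
       (forall u, u \in s -> M u) -> (forall u, u \in s' -> M u) -> s = s') ->
  exists l : seq (seq K), forall s, F s -> s \in l.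
Proof.
move=> st Rx x0 Fx Fprop Fdisj.
pose over (l : seq (seq K)) N :=
  exists s : seq K, [/\ s \in l, F s & forall u, u \in s -> N u].
have overl (l l' : seq (seq K)) N : {subset l <= l'} -> over l N -> over l' N.
  by move=> ll [s [/ll sl Fs sN]]; exists s.
have overL l l' N : over l N -> over (l ++ l') N.
  by apply: overl => s; rewrite mem_cat => ->.
have overR l l' N : over l' N -> over (l ++ l') N.
  by apply: overl => s; rewrite mem_cat orbC => ->.
pose T (s : seq K) N z := forall u v, u \in s -> v \in s -> locm N R (z * u * v).
(* [B] plays the part of the sum of all [(R : s^2)], described locally; [l] lists the finitely many
   [s] over which [z] may leave [R_N]. *)
pose B z := exists l, forall N, t_max R N ->
  (locm N R z \/ over l N) /\ (forall s, F s -> (forall u, u \in s -> N u) -> T s N z).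
have smB : submod R B.
  split=> [|y z [l ly] [l' lz]|r z Rr [l lz]].
  - exists [::] => N /t_max_prime/locm_mem LI; split=> [|s _ _ u v _ _].
      by left; apply: LI.
    by rewrite !mul0r; apply: LI.
  - exists (l ++ l') => N tN.
    have [_ LD _] := locm_submodR (t_max_prime tN) submodR.
    have [Ny Ty] := ly N tN; have [Nz Tz] := lz N tN.
    split=> [|s Fs sN u v su sv]; last first.
      by rewrite !mulrDl; apply: LD; [exact: (Ty s)|exact: (Tz s)].
    case: Ny => [Ny|/overL]; last by right.
    by case: Nz => [Nz|/overR]; [left; apply: LD|right].
  - exists l => N tN.
    have [_ _ LZ] := locm_submodR (t_max_prime tN) submodR.
    have [Nz Tz] := lz N tN; split=> [|s Fs sN u v su sv].
      by case: Nz => [/LZ|]; [left; auto|right].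
    rewrite -!(mulrA r); apply: LZ => //; exact: (Tz s).
(* [A] is [x^2 B]; it lies in [R] because [x] belongs to every [s]. *)
pose c := (x * x)^-1; pose A z := B (c * z).
have xx0 : x * x != 0 by rewrite mulf_neq0.
have smA : submod R A by apply: submod_scale.
have AR : incl A R.
  move=> z [l lz]; apply: t_max_cap => N tN; have [Nz Tz] := lz N tN.
  have zE : z = c * z * x * x by rewrite /c; field.
  case: Nz => [Nz|[s [_ Fs sN]]]; rewrite zE; last first.
    by apply: (Tz s) => //; apply: Fx.
  have [_ _ LZ] := locm_submodR (t_max_prime tN) submodR.
  by rewrite mulrC mulrA [_ * (c * z)]mulrC -mulrA mulrC; apply: LZ => //; apply: RM.
have Axx : A (x * x).
  exists [::] => N tN; rewrite /c mulVf //.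
  have LI := locm_mem (t_max_prime tN); split=> [|s _ sN u v su sv].
    by left; apply: LI.
  have [[[_ NR] _ _] _ _] := tN.
  by rewrite mul1r; apply: LI; apply: RM; apply/NR/sN.
have wI : w_ideal R (wcl R A) by apply: w_ideal_wcl => //; exists (x * x).
set I := wcl R A in wI; pose X := colon (Eend I) I.
have AI : incl A I by apply: wcl_mem.
have smI : submod R I by apply: submod_wcl.
have smX : submod R X by do 2!apply: submod_colon.
have [X0 XD XZ] := smX.
(* [I] and [A] agree locally, so [I] gives way to [A], whose elements are explicit. *)
have AX1 M : t_max R M -> locm M (mulm A X) 1.
  move=> tM; have pM := t_max_prime tM.
  have /(w_stable_idealP wI)/(_ M tM) IX := st I wI.
  apply: (locm_locm pM); apply: locmS IX.
  have [L0 LD LZ] := locm_submodR pM (submod_mulm X smA).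
  apply: mulm_min => // a b /(wclE _ smA)/(_ M tM) Aa /(locm_mem pM) Xb.
  by apply: (locm_mul pM _ Aa Xb) => *; apply: mulm_mem.
have [h []//|M tM|hs hsP hs1] := @t_max_compact (fun h => R h /\ mulm A X h).
  by have [h [Rh Mh]] := AX1 M tM; rewrite mulr1; exists h.
(* [c A] is [B], which is locally in [R_N] off a finite list; there [c * h] stays in [X R_N]. *)
pose Q l h := forall N, t_max R N -> locm N X (c * h) \/ over l N.
have AXQ h : mulm A X h -> exists l, Q l h.
  move: h; apply: mulm_min => [|y z [l ly] [l' lz]|a b [l la] Xb].
  - exists [::] => N /t_max_prime/locm_mem LI; left; rewrite mulr0; exact: LI.
  - exists (l ++ l') => N tN.
    have [_ LD _] := locm_submodR (t_max_prime tN) smX.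
    have [Ny|/overL] := ly N tN; last by right.
    have [Nz|/overR] := lz N tN; last by right.
    by left; rewrite mulrDr; apply: LD.
  - exists l => N tN; have [[Na|Na] _] := la N tN; [left|by right].
    have pN := t_max_prime tN.
    rewrite mulrA; apply: (locm_mul pN _ Na (locm_mem pN Xb)) => *; exact: XZ.
have [l lP] : exists l, forall h, h \in hs -> Q l h.
  elim: hs hsP {hs1} => [|h hs IH] hsP; first by exists [::].
  have [l lP] := IH (fun g gs => hsP g (@mem_behead _ (h :: hs) g gs)).
  have [_ /AXQ[l' l'P]] := hsP h (mem_head _ _).
  exists (l ++ l') => g; rewrite inE => /orP[/eqP ->|/lP gP] N tN.
    by have [|/overR] := l'P N tN; [left|right].
  by have [|/overL] := gP N tN; [left|right].
exists l => s Fs; apply: contrapT => nsl.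
have [M [tM sM]] := Fprop s Fs; have pM := t_max_prime tM.
have xs := Fx s Fs.
have [h hhs nMh] := vseq1_notin hs1 tM.
(* By comaximality [M] is over no member of [l], and [h] is a unit at [M]. *)
have Xc : locm M X c.
  have [Rh _] := hsP h hhs.
  have [[t [Rt Mt Xt]]|[s' [s'l Fs' s'M]]] := lP h hhs M tM; last first.
    by case: nsl; rewrite (Fdisj s s' M).
  exists (t * h); rewrite -mulrA [h * c]mulrC.
  by split; [apply: RM|apply: (prime_notinM pM)|].
(* One denominator [t] brings [t * z] into [B] with exceptional list [[:: s]]: at other [N], the
   square of some [u] in [s] clears it. *)
have TB z : T s M z -> locm M B z.
  move=> Tz.
  have [t [Rt Mt tP]] : exists t, [/\ R t, ~ M t &
      forall uv : K * K, uv \in [seq (u, v) | u <- s, v <- s] ->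
        R (t * (z * uv.1 * uv.2))].
    apply: common_multiple => // [uv r t Rr|uv].
      by rewrite -(mulrA r); apply: RM.
    by case/allpairsP=> -[u v] /= [us vs ->]; apply: Tz.
  have tzR u v : u \in s -> v \in s -> R (t * z * u * v).
    move=> us vs; have := tP _ (allpairs_f (fun u v => (u, v)) us vs).
    by rewrite /= !mulrA.
  exists t; split=> //; exists [:: s] => N tN; have pN := t_max_prime tN.
  have LI := locm_mem pN; have [[[_ NR] _ _] _ _] := tN.
  have [_ _ NZ] := locm_submodR pN submodR.
  have [sN|/existsNP[u /not_implyP[us nNu]]] := pselect (forall u, u \in s -> N u).
    split; first by right; exists s; rewrite inE.
    move=> s' Fs' s'N u v; rewrite -(Fdisj s s' N) // => us vs.
    exact/LI/tzR.
  have Ru : R u by have [[[_ MR] _ _] _ _] := tM; apply/MR/sM.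
  have Ntz : locm N R (t * z).
    exists (u * u); split; [exact: RM|exact: (prime_notinM pN)|].
    by rewrite mulrC mulrA; apply: tzR.
  split=> [|s' _ s'N v w /s'N/NR Rv /s'N/NR Rw]; first by left.
  by rewrite -mulrA mulrC; apply: NZ => //; apply: RM.
have BT z : locm M B z -> T s M z.
  move=> [t [Rt Mt [l' l'P]]] u v us vs; have [_ /(_ s Fs sM) Tz] := l'P M tM.
  apply: (locm_locm pM); exists t; split=> //; rewrite !mulrA; exact: Tz.
apply: (stable_colon_sqr_not_ring pM (w_stable_local st tM) xs x0 sM) => z z' Tz Tz'.
have AB y : locm M B y -> locm M A (x * x * y).
  move=> [t [Rt Mt Bty]]; exists t; split=> //; rewrite /A.
  by have -> : c * (t * (x * x * y)) = t * y by rewrite /c; field.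
(* As [c] is in [X R_M], [c A A] is locally in [A], so [B R_M], which is [(R_M : s^2)], is closed
   under products. *)
have Xcz : locm M (colon I A) (c * (x * x * z)).
  apply: (locm_mul pM _ Xc (AB _ (TB _ Tz))) => y a Xy Aa b Ab.
  by apply: Xy; apply: AI.
have : locm M I (c * (x * x * z) * (x * x * z')).
  by apply: (locm_mul pM _ Xcz (AB _ (TB _ Tz'))) => y a; apply.
move=> Ixx; have [t [Rt Mt]] : locm M A (c * (x * x * z) * (x * x * z')).
  by apply: (locm_locm pM); apply: locmS Ixx => y /(wclE _ smA); apply.
move=> At; apply: BT; exists t; split=> //; move: At; rewrite /A /c; congr B.
by field.
Qed.

(** * Separation of [t]-maximal ideals and finite character *)

Lemma t_max_sub_eq M N : t_max R M -> t_max R N -> incl M N -> M = N.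
Proof.
move=> [_ _ Mmax] [tN Np _] MN; apply/predeqP => x.
by have := Mmax N tN Np MN x; tauto.
Qed.

Lemma t_max_neq_sep M N : t_max R M -> t_max R N -> M <> N ->
  exists2 x, M x & ~ N x.
Proof.
move=> tM tN MN; apply: contrapT => nsep; apply: MN; apply: t_max_sub_eq => // x Mx.
by apply: contrapT => nNx; apply: nsep; exists x.
Qed.

(** For [m] in [M] outside [N], no [t]-maximal ideal contains [N] and [m]; compactness leaves [m]
    and finitely many elements of [N]. *)
Lemma t_max_split M N : t_max R M -> t_max R N -> M <> N ->
  exists s t : seq K, [/\ forall u, u \in s -> M u, forall u, u \in t -> N u &
    forall P, t_max R P -> (forall u, u \in s -> P u) ->
      ~ (forall u, u \in t -> P u)].
Proof.
move=> tM tN MN; have [m Mm nNm] := t_max_neq_sep tM tN MN.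
have [[[_ MR] _ _] _ _] := tM; have [[[_ NR] _ _] _ _] := tN.
have [|P tP|hs hsN hs1] := @t_max_compact (fun x => N x \/ x = m).
- by move=> x [/NR|->] //; apply: MR.
- have [<-|NP] := pselect (N = P); first by exists m; [right|].
  by have [y Ny nPy] := t_max_neq_sep tN tP NP; exists y; [left|].
exists [:: m], [seq h <- hs | `[< N h >]]; split=> [u|u|P tP mP tP'].
- by rewrite inE => /eqP ->.
- by rewrite mem_filter => /andP[/asboolP].
have [h hhs] := vseq1_notin hs1 tP; case.
have [Nh|->] := hsN h hhs; last by apply: mP; rewrite inE.
by apply: tP'; rewrite mem_filter hhs andbT; apply/asboolP.
Qed.

Definition homogeneous (s : seq K) M := [/\ t_max R M, forall u, u \in s -> M u &
  forall N, t_max R N -> (forall u, u \in s -> N u) -> N = M].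

Section FiniteCharacter.
Hypothesis R_stable : w_stable R.
Variable x : K.
Hypotheses (Rx : R x) (x0 : x != 0).

(* Otherwise repeated splitting yields an infinite [t]-comaximal family. *)
Lemma homogeneous_exists (s0 : seq K) M0 : x \in s0 -> t_max R M0 ->
    (forall u, u \in s0 -> M0 u) ->
  exists s M, {subset s0 <= s} /\ homogeneous s M.
Proof.
move=> xs0 tM0 sM0; apply: contrapT => nhom.
pose Q (s : seq K) := {subset s0 <= s} /\
  exists M, t_max R M /\ forall u, u \in s -> M u.
(* The implication sits under the existential so that [choice] yields a total function; off [Q] its
   value is arbitrary. *)
have Qsplit (s : seq K) : exists p : seq K * seq K, Q s -> [/\ Q p.1, Q p.2,
    {subset s <= p.1}, {subset s <= p.2} & forall P, t_max R P ->
      (forall u, u \in p.1 -> P u) -> ~ (forall u, u \in p.2 -> P u)].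
  have [[s0s [M [tM sM]]]|] := pselect (Q s); last by exists (s, s).
  have [N [tN sN MN]] : exists N, [/\ t_max R N, forall u, u \in s -> N u & M <> N].
    apply: contrapT => nN; apply: nhom; exists s, M; split=> //; split=> // N tN sN.
    by apply: contrapT => NM; apply: nN; exists N; split=> // MN; apply: NM.
  have [a [b [aM bN ab]]] := t_max_split tM tN MN.
  exists (s ++ a, s ++ b) => _ /=.
  have sub t : {subset s <= s ++ t} by move=> u us; rewrite mem_cat us.
  split=> //; try by split=> [u /s0s/sub//|]; [exists M + exists N]; split=> // u;
    rewrite mem_cat => /orP[]; auto.
  by move=> P tP aP bP; apply: (ab P tP) => u us; [apply: aP|apply: bP];
    rewrite mem_cat us orbT.
(* [a k] is the half split off at stage [k], [c k] the half still to be split. *)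
have [g gP] := choice Qsplit.
pose c k := iter k (fun s => (g s).2) s0; pose a k := (g (c k)).1.
have Qc k : Q (c k).
  by elim: k => [|k /gP[]] //; split=> //; exists M0.
have cS k l : (k <= l)%N -> {subset c k <= c l}.
  elim: l => [|l IH]; first by rewrite leqn0 => /eqP ->.
  rewrite leq_eqVlt => /orP[/eqP -> //|/IH kl] u /kl.
  by have [_ _ _ + _] := gP _ (Qc l); apply.
have aP k : Q (a k) by have [] := gP _ (Qc k).
(* [a l] extends [c k.+1], the half comaximal to [a k]. *)
have adisj k l P : (k < l)%N -> t_max R P -> (forall u, u \in a k -> P u) ->
    ~ (forall u, u \in a l -> P u).
  move=> kl tP akP alP; have [_ _ _ _ /(_ P tP akP)] := gP _ (Qc k); apply.
  move=> u /(cS k.+1 l kl) ul; apply: alP.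
  by have [_ _ + _ _] := gP _ (Qc l); apply.
have ainj k l P : t_max R P -> (forall u, u \in a k -> P u) ->
    (forall u, u \in a l -> P u) -> k = l.
  move=> tP akP alP; have [kl|lk|//] := ltngtP k l.
    by case: (adisj k l P kl).
  by case: (adisj l k P lk).
have [||s s' P [k ->] [l ->] tP kP lP|l lP] :=
    @t_comaximal_family_finite x (fun s => exists k, s = a k) R_stable Rx x0.
- by move=> s [k ->]; have [+ _] := aP k; apply.
- by move=> s [k ->]; have [_] := aP k.
- by rewrite (ainj k l P).
have a_uniq : uniq [seq a k | k <- iota 0 (size l).+1].
  rewrite map_inj_uniq ?iota_uniq // => k k' akk'.
  have [_ [P [tP kP]]] := aP k; apply: (ainj _ _ P) => //.
  by rewrite -akk'.
have := @uniq_leq_size _ _ l a_uniq; rewrite size_map size_iota ltnn => nsub.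
suff: false by [].
by apply: nsub => _ /mapP[k _ ->]; apply: lP; exists k.
Qed.

(** One homogeneous list for each isolated ideal forms a [t]-comaximal family, so isolated ideals
    are finite in number. Every [t]-maximal ideal containing [x] is isolated, since otherwise its
    elements outside the known ones would lead to a further isolated ideal. *)
Lemma w_stable_finite_char : exists (n : nat) (f : nat -> K -> Prop),
  forall M, t_max R M -> M x -> exists i, (i < n)%N /\ seteq M (f i).
Proof.
pose isolated M := exists s, x \in s /\ homogeneous s M.
have pickM M : exists s, isolated M -> x \in s /\ homogeneous s M.
  have [[s sP]|nM] := pselect (isolated M); first by exists s.
  by exists [::] => /nM.
have [pk pkP] := choice pickM.
have [||s s' P [M [isM ->]] [M' [isM' ->]] tP sP s'P|l lP] :=
    @t_comaximal_family_finite x (fun s => exists M, isolated M /\ s = pk M)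
      R_stable Rx x0.
- by move=> s [M [/pkP[+ _] ->]].
- by move=> s [M [/pkP[_ [tM sM _]] ->]]; exists M.
- have [_ [_ _ uM]] := pkP M isM; have [_ [_ _ uM']] := pkP M' isM'.
  by rewrite -(uM P tP sP) -(uM' P tP s'P).
have homE s M M' : homogeneous s M -> homogeneous s M' -> M = M'.
  by move=> [tM sM _] [_ _]; apply.
have isoT M : t_max R M -> M x -> isolated M.
  move=> tM Mx; apply: contrapT => nisM.
  (* A list is homogeneous for at most one [M']; if for none, [x] is a mere default. *)
  have sep s : exists y, M y /\
      forall M', x \in s -> homogeneous s M' -> ~ M' y.
    have [[M' [xs hM']]|nM'] := pselect (exists M', x \in s /\ homogeneous s M').
      have [tM' _ _] := hM'.
      have [|z Mz nM'z] := @t_max_neq_sep M M' tM tM'.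
        by move=> MM'; apply: nisM; exists s; rewrite MM'.
      by exists z; split=> // M'' _ /homE/(_ hM') ->.
    by exists x; split=> // M' xs hM'; case: nM'; exists M'.
  have [y yP] := choice sep.
  (* The resulting [M'] contains the [y] of its own list [pk M'], which was chosen outside [M']. *)
  have [||s [M' [ss hM']]] := @homogeneous_exists (x :: map y l) M _ tM.
  - by rewrite mem_head.
  - by move=> u; rewrite inE => /orP[/eqP -> //|/mapP[s _ ->]]; case: (yP s).
  have isM' : isolated M' by exists s; split=> //; apply: ss; rewrite mem_head.
  have [xM' hpk] := pkP M' isM'; have [_ /(_ M' xM' hpk)] := yP (pk M'); apply.
  have [_ + _] := hM'; apply; apply: ss; rewrite inE orbC map_f //.
  by apply: lP; exists M'.
(* The existential recovers the ideal from its homogeneous list, which determines it. *)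
exists (size l), (fun i z => exists M, homogeneous (nth [::] l i) M /\ M z) => M tM Mx.
have isM := isoT M tM Mx; have [_ hM] := pkP M isM.
have pkl : pk M \in l by apply: lP; exists M.
exists (index (pk M) l); rewrite index_mem pkl; split=> // z; rewrite nth_index //.
split=> [Mz|[M' [hM' M'z]]]; first by exists M.
by rewrite (homE _ _ _ hM hM').
Qed.

End FiniteCharacter.

End Domain.

Theorem theorem2p2 (K : fieldType) (R : K -> Prop) :
  subring R -> quotient_field R -> (exists x : K, ~ R x) ->
  (w_stable R <->
     (forall I, w_ideal R I -> seteq (colon (Eend I) (colon (Eend I) I)) I)) /\
  (w_stable R <->
     (t_finite_character R /\ forall M, t_max R M -> stable_domain (loc R M))).
Proof.
move=> R_subring R_frac R_proper; split; split.
- by move=> st I wI; apply: w_stable_divisorial (st I wI).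
- exact: divisorial_w_stable.
- move=> st; split=> [x Rx x0|M tM]; first exact: w_stable_finite_char.
  exact: w_stable_local.
- by move=> [tfc stR]; apply: local_w_stable.
Qed.
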